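(* Let $p$ be a prime. A finite $p$-group $P$ is strongly resistant in saturated fusion systems if and only if it is resistant in semisaturated fusion systems.
   Context: All groups are finite and maps are written on the right. Fusion systems and saturated fusion systems on finite $p$-groups are understood in the standard sense. For a fusion system $\mathcal F$ on $S$, $P\le S$ is strongly $\mathcal F$-closed if $x\phi\in P$ for all $x\in P$ and $\phi\in\mathrm{Hom}_{\mathcal F}(\langle x\rangle,S)$; $P\unlhd\mathcal F$ means $P\unlhd S$ and every morphism $\phi:A\to B$ in $\mathcal F$ extends to a morphism $\overline\phi: PA\to PB$ in $\mathcal F$ with $P\overline\phi=P$. A $p$-group $P$ is strongly resistant in saturated fusion systems if $P\unlhd\mathcal F$ whenever $S\ge P$ is a $p$-group and $\mathcal F$ is a saturated fusion system on $S$ such that $P$ is strongly $\mathcal F$-closed. A fusion system $\mathcal E$ on $P$ is semisaturated if there exist a $p$-group $S\ge P$ and a saturated fusion system $\mathcal F\ge\mathcal E$ on $S$ such that $P$ is strongly $\mathcal F$-closed and $\mathcal E=\mathcal F_{|\le P}$, i.e. $\mathrm{Hom}_{\mathcal E}(A,B)=\mathrm{Hom}_{\mathcal F}(A,B)$ for all $A,B\le P$. $P$ is resistant in semisaturated fusion systems if $P\unlhd\mathcal E$ for every semisaturated fusion system $\mathcal E$ on $P$. *)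

(* Defs.v *)
From mathcomp Require Import all_boot all_fingroup all_solvable.

Set Implicit Arguments.
Unset Strict Implicit.
Unset Printing Implicit Defensive.

Local Open Scope group_scope.

(* The hom-sets of a fusion system.  A morphism from A to B is represented by
   any function on the ambient type with the right values on A; its values
   outside A are irrelevant (see [fusion_ext] below). *)
Definition hom_system (gT : finGroupType) :=
  {group gT} -> {group gT} -> pred (gT -> gT).

Definition inj_hom (gT : finGroupType) (A B : {group gT}) (f : gT -> gT) :=
  [/\ morphic A f, {in A &, injective f} & f @: A \subset B].

Definition fusion_iso (gT : finGroupType) (F : hom_system gT)
    (A B : {group gT}) (f : gT -> gT) : Prop :=
  F A B f /\ exists2 g, F B A g & {in A, cancel f g} /\ {in B, cancel g f}.

Record fusion_system (p : nat) (gT : finGroupType) (S : {group gT})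
    (F : hom_system gT) : Prop := FusionSystem {
  fusion_pgroup : p.-group S;
  fusion_obj : forall A B f, F A B f -> A \subset S /\ B \subset S;
  fusion_inj : forall A B f, F A B f -> inj_hom A B f;
  fusion_ext : forall A B f g, F A B f -> {in A, f =1 g} -> F A B g;
  fusion_conj : forall (A B : {group gT}) s, A \subset S -> B \subset S ->
    s \in S -> A :^ s \subset B -> F A B (conjg^~ s);
  fusion_comp : forall A B C f g, F A B f -> F B C g -> F A C (g \o f);
  (* Every morphism is an isomorphism of the system followed by an inclusion. *)
  fusion_factor : forall A B f, F A B f ->
    exists2 C : {group gT}, C \subset B & fusion_iso F A C f
}.

Section Saturation.

Variables (p : nat) (gT : finGroupType) (S : {group gT}) (F : hom_system gT).

Definition fusion_conjugate (A B : {group gT}) : Prop :=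
  exists f, fusion_iso F A B f.

Definition Aut_fusion (A : {group gT}) : {set {perm gT}} :=
  [set a in Aut A | F A A a].

Definition fully_normalized (A : {group gT}) : Prop :=
  forall B, fusion_conjugate A B -> #|'N_S(B)| <= #|'N_S(A)|.

Definition fully_centralized (A : {group gT}) : Prop :=
  forall B, fusion_conjugate A B -> #|'C_S(B)| <= #|'C_S(A)|.

(* [conj_aut A @* 'N_S(A)] is Aut_S(A). *)
Definition fully_automized (A : {group gT}) : bool :=
  p.-Sylow(Aut_fusion A) (conj_aut A @* 'N_S(A)).

(* N_f for an isomorphism f : A -> C, i.e. the g in N_S(A) such that
   f^-1 c_g f lies in Aut_S(C). *)
Definition Nphi (A C : {group gT}) (f : gT -> gT) : {set gT} :=
  [set g in 'N_S(A) |
    [exists h in 'N_S(C), forall x in A, f (x ^ g) == f x ^ h]].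

Lemma Nphi_group_set A C f : group_set (Nphi A C f).
Proof.
apply/group_setP; split=> [|g h].
  rewrite inE group1; apply/exists_inP; exists 1 => //.
  by apply/forall_inP=> x _; rewrite !conjg1.
rewrite ![_ \in Nphi _ _ _]in_set.
case/andP=> NSg /exists_inP[g' Ng' /forall_inP Eg].
case/andP=> NSh /exists_inP[h' Nh' /forall_inP Eh].
rewrite groupM //=.
apply/exists_inP; exists (g' * h'); first exact: groupM.
apply/forall_inP=> x Ax; rewrite !conjgM.
have Axg : x ^ g \in A by rewrite memJ_norm //; case/setIP: NSg.
by rewrite (eqP (Eh _ Axg)) (eqP (Eg _ Ax)).
Qed.

Canonical Nphi_group A C f := Group (Nphi_group_set A C f).

(* Saturation in the sense of Broto, Levi and Oliver. *)
Record saturated : Prop := Saturated {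
  saturated_fusion : fusion_system p S F;
  saturated_sylow : forall A : {group gT}, A \subset S ->
    fully_normalized A -> fully_centralized A /\ fully_automized A;
  saturated_extension : forall A C f,
    fusion_iso F A C f -> fully_centralized C ->
    exists2 g, F (Nphi A C f)%G S g & {in A, g =1 f}
}.

Definition strongly_closed (P : {group gT}) : Prop :=
  P \subset S /\
  (forall x f, x \in P -> F <[x]>%G S f -> f x \in P).

(* When P is normal in S, [P <*> A] is the product PA. *)
Definition normal_in_fusion (P : {group gT}) : Prop :=
  P <| S /\
  (forall A B f, F A B f ->
     exists g, [/\ F (P <*> A)%G (P <*> B)%G g, {in A, g =1 f} & g @: P = P]).

End Saturation.

(* An overgroup S of P may live in a different ambient type; it is given with
   an injective morphism j embedding P in S. *)
Definition strongly_resistant (p : nat) (gT : finGroupType) (P : {group gT}) :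
    Prop :=
  forall (sT : finGroupType) (S : {group sT}) (j : {morphism P >-> sT})
         (F : hom_system sT),
    'injm j -> saturated p S F -> strongly_closed S F (j @* P)%G ->
    normal_in_fusion S F (j @* P)%G.

(* The restriction of F to the subgroups of j @* P, transported to P along j. *)
Definition fusion_restr (gT sT : finGroupType) (P : {group gT})
    (j : {morphism P >-> sT}) (injj : 'injm j) (F : hom_system sT) :
    hom_system gT :=
  fun A B f => [&& A \subset P, B \subset P, f @: A \subset B
                 & F (j @* A)%G (j @* B)%G (j \o f \o invm injj)].

Definition semisaturated (p : nat) (gT : finGroupType) (P : {group gT})
    (E : hom_system gT) : Prop :=
  fusion_system p P E /\
  exists (sT : finGroupType) (S : {group sT}) (j : {morphism P >-> sT})
         (injj : 'injm j) (F : hom_system sT),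
    [/\ saturated p S F, strongly_closed S F (j @* P)%G
      & forall A B f, E A B f = fusion_restr injj F A B f].

Definition resistant_semisaturated (p : nat) (gT : finGroupType)
    (P : {group gT}) : Prop :=
  forall E : hom_system gT, semisaturated p P E -> normal_in_fusion P E P.

(* Main.v *)
Require Import Defs.
From mathcomp Require Import all_boot all_fingroup all_solvable.

Set Implicit Arguments.
Unset Strict Implicit.
Unset Printing Implicit Defensive.

Local Open Scope group_scope.

(* If P is normal in the restriction E of F to subgroups of P, every morphism
   of F between subgroups of P extends to an automorphism of P in F, so every
   characteristic subgroup of P is strongly F-closed.  In particular the upper
   central series of P, followed by S, is a chain of strongly closed subgroups
   T 0 = 1 <= ... <= T n = S with [T (i+1), P] <= T i, and such a chain makes P
   normal in F.  Indeed one extends f : A -> S to PA by descending induction on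
   |A|.  As in Alperin's fusion theorem, replacing A by a fully normalized
   conjugate reduces to f in Aut_F(A).  There N_P(A) acts through the stabilizer
   of the chain (A :&: T i), a normal p-subgroup of Aut_F(A); hence N_P(A) lies in
   N_f and f extends to A N_P(A), which is larger than A unless P <= A. *)

(** * Morphisms of a fusion system, strongly closed subgroups and automizers *)

Section FusionSystem.

Variables (p : nat) (gT : finGroupType) (S : {group gT}) (F : hom_system gT).
Hypothesis fusF : fusion_system p S F.
Implicit Types A B C Q : {group gT}.

Lemma inj_hom_group A B f : inj_hom A B f ->
  exists C : {group gT}, f @: A = C.
Proof.
case=> mf _ _; exists (morphm mf @* A)%G.
by rewrite /= morphimEdom.
Qed.

Lemma fusion_dom A B f : F A B f -> A \subset S.
Proof. by case/(fusion_obj fusF). Qed.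

Lemma fusion_cod A B f : F A B f -> B \subset S.
Proof. by case/(fusion_obj fusF). Qed.

Lemma fusion_mem A B f x : F A B f -> x \in A -> f x \in B.
Proof.
case/(fusion_inj fusF)=> _ _ /subsetP sfAB Ax.
by apply: sfAB; apply: imset_f.
Qed.

Lemma fusionM A B f : F A B f -> {in A &, {morph f : x y / x * y}}.
Proof. by case/(fusion_inj fusF)=> /morphicP. Qed.

Lemma fusion1 A B f : F A B f -> f 1 = 1.
Proof.
case/(fusion_inj fusF)=> mf _ _.
exact: (morph1 (morphm_morphism mf)).
Qed.

Lemma fusionJ A B f : F A B f -> {in A &, {morph f : x y / x ^ y}}.
Proof.
case/(fusion_inj fusF)=> mf _ _ x y Ax Ay.
exact: (morphJ (morphm_morphism mf)).
Qed.

Lemma fusion_incl A B : A \subset B -> B \subset S -> F A B id.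
Proof.
move=> sAB sBS.
apply: (fusion_ext fusF (f := conjg^~ 1)) => [|x _]; last by rewrite conjg1.
apply: (fusion_conj fusF) => //; first exact: subset_trans sBS.
by rewrite conjsg1.
Qed.

Lemma fusion_sub A A0 B f : A0 \subset A -> F A B f -> F A0 B f.
Proof.
move=> sA0 Ff.
apply: (fusion_ext fusF (f := f \o id)) => //.
exact: (fusion_comp fusF (fusion_incl sA0 (fusion_dom Ff)) Ff).
Qed.

Lemma fusion_widen A B B1 f : B \subset B1 -> B1 \subset S ->
  F A B f -> F A B1 f.
Proof.
move=> sB1 sBS Ff.
apply: (fusion_ext fusF (f := id \o f)) => //.
exact: (fusion_comp fusF Ff (fusion_incl sB1 sBS)).
Qed.

Lemma fusion_iso_im A C f : fusion_iso F A C f -> f @: A = C.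
Proof.
case=> Ff [g Fg [_ fgK]]; apply/eqP; rewrite eqEsubset; apply/andP; split.
  by apply/subsetP=> _ /imsetP[x Ax ->]; apply: fusion_mem Ff Ax.
apply/subsetP=> y Cy; rewrite -(fgK y Cy); apply: imset_f.
exact: fusion_mem Fg Cy.
Qed.

(** The factorization axiom makes f an isomorphism of the system onto some D, and D can only be the
    image of A. *)
Lemma fusion_isoP A B C f : F A B f -> f @: A = C -> fusion_iso F A C f.
Proof.
move=> Ff imf; have [D _ isoD] := fusion_factor fusF Ff.
suff -> : C = D by [].
by apply: val_inj; rewrite /= -imf (fusion_iso_im isoD).
Qed.

Lemma fusion_corestrict A B C f : F A B f -> f @: A \subset C ->
  C \subset S -> F A C f.
Proof.
move=> Ff sfC sCS; have [D imf] := inj_hom_group (fusion_inj fusF Ff).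
have [FD _] := fusion_isoP Ff imf.
by apply: fusion_widen FD => //; rewrite -imf.
Qed.

Lemma fusion_iso_comp A B C f g :
  fusion_iso F A B f -> fusion_iso F B C g -> fusion_iso F A C (g \o f).
Proof.
move=> isof isog; have [Ff _] := isof; have [Fg _] := isog.
apply: (fusion_isoP (fusion_comp fusF Ff Fg)).
by rewrite imset_comp (fusion_iso_im isof) (fusion_iso_im isog).
Qed.

Lemma strongly_closed_mem Q A B f x : strongly_closed S F Q ->
  F A B f -> x \in A -> x \in Q -> f x \in Q.
Proof.
case=> _ cloQ Ff Ax Qx; apply: cloQ => //.
have sxA : <[x]> \subset A by rewrite cycle_subG.
exact: fusion_widen (fusion_cod Ff) (subxx _) (fusion_sub sxA Ff).
Qed.

Lemma strongly_closed_im Q A B f : strongly_closed S F Q ->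
  F A B f -> Q \subset A -> f @: Q = Q.
Proof.
move=> cloQ Ff sQA; apply/eqP; rewrite eqEcard.
have [_ injf _] := fusion_inj fusF Ff.
rewrite card_in_imset ?leqnn ?andbT; last exact: sub_in2 (subsetP sQA) _ injf.
apply/subsetP=> _ /imsetP[x Qx ->].
exact: strongly_closed_mem cloQ Ff (subsetP sQA x Qx) Qx.
Qed.

Lemma strongly_closed_normal Q : strongly_closed S F Q -> Q <| S.
Proof.
move=> cloQ; have [sQS _] := cloQ.
apply/andP; split=> //; apply/subsetP=> s Ss; rewrite inE.
have Fs : F S S (conjg^~ s) by apply: (fusion_conj fusF); rewrite // conjGid.
apply/subsetP=> _ /imsetP[x Qx ->].
exact: strongly_closed_mem cloQ Fs (subsetP sQS x Qx) Qx.
Qed.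

Section Automorphisms.

Variable A : {group gT}.
Hypothesis sAS : A \subset S.

Lemma Aut_fusion_group_set : group_set (Aut_fusion F A).
Proof.
apply/group_setP; split=> [|a b].
  rewrite inE group1 /=; apply: fusion_ext fusF _ _ _ _ (fusion_incl _ sAS) _ => //.
  by move=> x _; rewrite perm1.
rewrite ![_ \in Aut_fusion _ _]in_set => /andP[Aa Fa] /andP[Ab Fb].
rewrite groupM //=.
apply: (fusion_ext fusF (fusion_comp fusF Fa Fb)) => x _.
by rewrite permM.
Qed.

Definition Aut_fusion_group := Group Aut_fusion_group_set.

Lemma Aut_fusion_hom a : a \in Aut_fusion F A -> F A A a.
Proof. by rewrite inE; case/andP. Qed.

Lemma Aut_fusion_Aut a : a \in Aut_fusion F A -> a \in Aut A.
Proof. by rewrite inE; case/andP. Qed.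

(** A morphism is constrained only on its domain; [perm_in] replaces f by a permutation that is
    trivial off A, hence by an element of [Aut A]. *)
Lemma Aut_fusionP f : F A A f ->
  exists2 a, a \in Aut_fusion F A & {in A, a =1 f}.
Proof.
move=> Ff; have [mf injf sfA] := fusion_inj fusF Ff.
have Ef := perm_inE injf sfA; exists (perm_in injf sfA) => //.
rewrite inE; apply/andP; split; last first.
  by apply: (fusion_ext fusF Ff) => x Ax; rewrite Ef.
rewrite inE perm_in_on /=.
apply/morphicP=> x y Ax Ay.
by rewrite !Ef ?groupM // (fusionM Ff).
Qed.

Lemma conj_Aut_fusion g : g \in 'N_S(A) -> conj_aut A g \in Aut_fusion F A.
Proof.
case/setIP=> Sg Ng; rewrite inE Aut_aut /=.
apply: (fusion_ext fusF (f := conjg^~ g)) => [|x Ax].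
  by apply: (fusion_conj fusF); rewrite ?(normP Ng).
by rewrite norm_conj_autE.
Qed.

End Automorphisms.

Lemma sub_Nphi A C f : fusion_iso F A C f -> A \subset Nphi S A C f.
Proof.
case=> Ff _; have sAS := fusion_dom Ff; apply/subsetP=> g Ag.
rewrite inE inE (subsetP sAS) // (subsetP (normG A)) //=.
have Cfg := fusion_mem Ff Ag.
apply/exists_inP; exists (f g).
  by rewrite inE (subsetP (fusion_cod Ff)) // (subsetP (normG C)).
by apply/forall_inP=> x Ax; rewrite (fusionJ Ff).
Qed.

Lemma fully_normalized_conjugate A : A \subset S -> exists C f,
  fusion_iso F A C f /\ fully_normalized S F C.
Proof.
move=> sAS.
(* Quantifying over finite functions turns [fusion_conjugate] into a boolean predicate, over which
   #|'N_S(B)| can be maximized. *)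
pose cj B := [exists f : {ffun gT -> gT}, F A B f && (f @: A == B)].
have cjP B f : fusion_iso F A B f -> cj B.
  move=> iso_f; have [Ff _] := iso_f; apply/existsP; exists (finfun f).
  have ef : f =1 finfun f by move=> x; rewrite ffunE.
  rewrite (fusion_ext fusF Ff) // -(fusion_iso_im iso_f).
  by apply/eqP/eq_imset => x; rewrite ffunE.
have cjA : cj A.
  apply: (cjP A id); apply: (fusion_isoP (fusion_incl (subxx A) sAS)).
  exact: imset_id.
case: (arg_maxnP (fun B : {group gT} => #|'N_S(B)|) cjA) => C.
case/existsP=> f /andP[Ff /eqP imf] maxC; exists C, f.
have isof := fusion_isoP Ff imf; split=> // B [g isog].
exact: maxC (cjP _ _ (fusion_iso_comp isof isog)).
Qed.

End FusionSystem.

(** * Saturated systems: extending morphisms to normalizers *)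

Section Saturated.

Variables (p : nat) (gT : finGroupType) (S : {group gT}) (F : hom_system gT).
Hypothesis satF : saturated p S F.
Let fusF := saturated_fusion satF.
Implicit Types A B C Q : {group gT}.

Lemma pgroup_Aut_fusion_J C (Y : {group {perm gT}}) :
    fully_normalized S F C -> C \subset S -> Y \subset Aut_fusion F C ->
    p.-group Y ->
  exists2 b, b \in Aut_fusion F C & Y :^ b \subset conj_aut C @* 'N_S(C).
Proof.
move=> nC sCS sYA pY; have [_ sylC] := saturated_sylow satF sCS nC.
exact: (Sylow_Jsub (G := Aut_fusion_group fusF sCS) sylC sYA pY).
Qed.

(** By Sylow's theorem, f can be followed by some b in Aut_F(C) so that Aut_S(A), transported to C,
    lands in Aut_S(C). For psi = b \o f the group N_psi is then all of 'N_S(A), and the extension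
    axiom applies because C is also fully centralized. *)
Lemma extend_to_normalizer A C f :
    fusion_iso F A C f -> fully_normalized S F C ->
  exists psi ext, [/\ fusion_iso F A C psi, F 'N_S(A)%G S ext
    & {in A, ext =1 psi}].
Proof.
move=> iso_f nC; have [Ff [h Fh [fK hK]]] := iso_f.
have sAS := fusion_dom fusF Ff; have sCS := fusion_cod fusF Ff.
(* Y is Aut_S(A) transported to C along f. *)
pose Y := [set a in Aut_fusion F C |
  [exists g in 'N_S(A), forall x in A, a (f x) == f (x ^ g)]].
have YP a g : a \in Aut_fusion F C -> g \in 'N_S(A) ->
    {in A, forall x, a (f x) = f (x ^ g)} -> a \in Y.
  move=> Fa Ng Ea; rewrite inE Fa; apply/exists_inP; exists g => //.
  by apply/forall_inP=> x Ax; rewrite Ea.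
have NA g x : g \in 'N_S(A) -> x \in A -> x ^ g \in A.
  by case/setIP=> _ Ng Ax; rewrite memJ_norm.
have gY : group_set Y.
  apply/group_setP; split=> [|a b].
    apply: (YP _ 1) => //; first exact: (group1 (Aut_fusion_group fusF sCS)).
    by move=> x _; rewrite perm1 conjg1.
  rewrite ![_ \in Y]in_set.
  case/andP=> Fa /exists_inP[g Ng /forall_inP Ea].
  case/andP=> Fb /exists_inP[k Nk /forall_inP Eb].
  have Fab := groupM (Fa : a \in Aut_fusion_group fusF sCS) Fb.
  have := YP _ (g * k) Fab (groupM Ng Nk); rewrite inE; apply=> x Ax.
  by rewrite permM (eqP (Ea x Ax)) (eqP (Eb _ (NA _ _ Ng Ax))) conjgM.
(* If a in Y comes from g, then a ^+ k comes from g ^+ k; as g lies in S, the exponent of Y divides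
   #|S|. *)
have pY : p.-group (Group gY).
  rewrite -pnat_exponent; apply: pnat_dvd (fusion_pgroup fusF).
  apply/exponentP=> a Ya; apply/permP=> y; rewrite perm1.
  have [Fa] : a \in Aut_fusion F C /\
      [exists g in 'N_S(A), forall x in A, a (f x) == f (x ^ g)].
    by apply/andP; move: Ya; rewrite inE.
  case/exists_inP=> g Ng /forall_inP Ea.
  have Ek k : {in A, forall x, (a ^+ k) (f x) = f (x ^ (g ^+ k))}.
    elim: k => [|k IHk] x Ax; first by rewrite perm1 conjg1.
    by rewrite expgSr permM IHk // (eqP (Ea _ (NA _ _ (groupX k Ng) Ax)))
      expgSr conjgM.
  have [Cy|nCy] := boolP (y \in C).
    have Ahy : h y \in A := fusion_mem fusF Fh Cy.
    rewrite -(hK y Cy) Ek //; have [Sg _] := setIP Ng.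
    by rewrite expg_cardG // conjg1.
  have := groupX #|S| (Aut_fusion_Aut Fa).
  rewrite inE => /andP[/subsetP ona _].
  by apply/eqP; apply: contraR nCy => /ona.
have sYA : Group gY \subset Aut_fusion F C.
  by apply/subsetP=> a; rewrite inE => /andP[].
have [b Fb sYb] := pgroup_Aut_fusion_J nC sCS sYA pY.
have FbC := Aut_fusion_hom Fb.
have [mb injb sbC] := fusion_inj fusF FbC.
have imb : b @: C = C.
  by apply/eqP; rewrite eqEcard sbC card_in_imset /=.
have iso_bf := fusion_iso_comp fusF iso_f (fusion_isoP fusF FbC imb).
have [cC _] := saturated_sylow satF sCS nC.
have [ext Fext Eext] := saturated_extension satF iso_bf cC.
exists (b \o f), ext; split=> //.
apply: (fusion_sub fusF _ Fext); apply/subsetP=> g Ng.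
rewrite inE Ng /=.
have sANg : A :^ g \subset A by case/setIP: Ng => _ Ng; rewrite (normP Ng).
have [Sg _] := setIP Ng.
(* The transport a of conjugation by g lies in Y, so a ^ b is conjugation by some k in 'N_S(C); this
   k witnesses that g is in N_psi. *)
have FaC := fusion_comp fusF (fusion_comp fusF Fh
  (fusion_conj fusF sAS sAS Sg sANg)) Ff.
have [a Fa Ea] := Aut_fusionP fusF FaC.
have Ya : a \in Y.
  apply: (YP _ g) => // x Ax.
  by rewrite Ea /= ?fK // (fusion_mem fusF Ff).
have /morphimP[k Nk NSk Eab] : a ^ b \in conj_aut C @* 'N_S(C).
  by apply: (subsetP sYb); rewrite memJ_conjg.
apply/exists_inP; exists k => //; apply/forall_inP=> x Ax; apply/eqP => /=.
have Cfx := fusion_mem fusF Ff Ax.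
rewrite -(norm_conj_autE Nk) ?(fusion_mem fusF FbC) // -Eab permJ.
by rewrite Ea //= fK.
Qed.

(** * Strongly closed subgroups centralized stepwise by P, and normality of P in F *)

Section CentralSeries.

Variables (P : {group gT}) (n : nat) (T : nat -> {group gT}).
Hypothesis closedT : forall i, strongly_closed S F (T i).
Hypothesis closedP : strongly_closed S F P.
Hypothesis T0 : T 0 = 1%G.
Hypothesis Tn : S \subset T n.
Hypothesis cenT : forall i, [~: T i.+1, P] \subset T i.

(** The stabilizer of the chain A :&: T i. Each [T i] being strongly closed, all of Aut_F(A)
    preserves A :&: T i, so only the congruence modulo [T i] is imposed. *)
Definition chain_aut A : {set {perm gT}} :=
  [set a in Aut_fusion F A |
    [forall i : 'I_n, forall x in A :&: T i.+1, x^-1 * a x \in T i]].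

Lemma chain_autP A a : reflect
  (a \in Aut_fusion F A /\ forall i x, i < n -> x \in A -> x \in T i.+1 ->
     x^-1 * a x \in T i)
  (a \in chain_aut A).
Proof.
rewrite [_ \in chain_aut A]in_set; apply: (iffP andP) => [][Fa Ta]; split=> //.
  move=> i x ltin Ax Tx.
  by have /forall_inP := forallP Ta (Ordinal ltin); apply; rewrite inE Ax.
by apply/forallP=> i; apply/forall_inP=> x /setIP[Ax Tx]; apply: Ta.
Qed.

Lemma chain_aut_group_set A : A \subset S -> group_set (chain_aut A).
Proof.
move=> sAS; apply/group_setP; split=> [|a b].
  apply/chain_autP; split=> [|i x _ _ _].
    exact: (group1 (Aut_fusion_group fusF sAS)).
  by rewrite perm1 mulVg group1.
case/chain_autP=> Fa Ta /chain_autP[Fb Tb]; apply/chain_autP.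
split=> [|i x ltin Ax Tx].
  exact: (groupM (Fa : a \in Aut_fusion_group fusF sAS) Fb).
have FaA := Aut_fusion_hom Fa.
(* x^-1 * b (a x) is the product of x^-1 * a x and (a x)^-1 * b (a x), where a x is still in T
   i.+1. *)
rewrite permM -(mulKVg (a x) (b (a x))) mulgA groupM ?Ta // Tb //.
  exact: (fusion_mem fusF FaA Ax).
exact: (strongly_closed_mem fusF (closedT i.+1) FaA).
Qed.

(** The exponent divides #|A| ^ n, a power of p: each further power #|A| makes an element fix one
    more term of the chain pointwise, from T 0 = 1 up to T n, which contains A. *)
Lemma pgroup_chain_aut A (sAS : A \subset S) :
  p.-group (Group (chain_aut_group_set sAS)).
Proof.
rewrite -pnat_exponent.
apply: (@pnat_dvd _ (#|A| ^ n)); last first.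
  by rewrite pnatX [p.-nat _](pgroupS sAS (fusion_pgroup fusF)).
apply/exponentP=> a /chain_autP[Fa Ta]; apply/permP=> y; rewrite perm1.
have AutX k : a ^+ k \in Aut_fusion F A.
  exact: (groupX k (Fa : a \in Aut_fusion_group fusF sAS)).
have TX k i x : i < n -> x \in A -> x \in T i.+1 ->
    x^-1 * (a ^+ k) x \in T i.
  have Ga : a \in Group (chain_aut_group_set sAS) by apply/chain_autP.
  by case/chain_autP: (groupX k Ga) => _; apply.
have [Ay|nAy] := boolP (y \in A); last first.
  have := Aut_fusion_Aut (AutX (#|A| ^ n)%N); rewrite inE => /andP[/subsetP ona _].
  by apply/eqP; apply: contraR nAy => /ona.
(* If b fixes A :&: T i pointwise and b x = x * c with c in A :&: T i, then
   b ^+ k maps x to x * c ^+ k. *)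
suffices fixT i : i <= n -> {in A, forall x, x \in T i -> (a ^+ (#|A| ^ i)) x = x}.
  by apply: fixT => //; apply: (subsetP (subset_trans sAS Tn)).
elim: i => [|i IHi] ltin x Ax; first by rewrite T0 => /set1P->;
  apply: (fusion1 fusF (Aut_fusion_hom (AutX _))).
move=> Tx; rewrite expnSr expgM; set b := a ^+ (#|A| ^ i).
have FbA := Aut_fusion_hom (AutX (#|A| ^ i)%N).
have Tc := TX (#|A| ^ i)%N i x ltin Ax Tx; set c := _ * _ in Tc.
have Ac : c \in A by rewrite groupM ?groupV ?(fusion_mem fusF FbA).
have bX k : (b ^+ k) x = x * c ^+ k.
  elim: k => [|k IHk]; first by rewrite perm1 mulg1.
  rewrite expgSr permM IHk (fusionM fusF FbA) ?groupX //.
  rewrite -/b (IHi (ltnW ltin) (c ^+ k)) ?groupX //.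
  by rewrite expgS mulgA /c mulKVg.
by rewrite bX expg_cardG // mulg1.
Qed.

(** With y = b^-1 x, the element x^-1 * (a ^ b) x equals b (y^-1 * a y), and b preserves A :&: T i
    by strong closure. *)
Lemma chain_aut_normal A (sAS : A \subset S) :
  Group (chain_aut_group_set sAS) <| Aut_fusion_group fusF sAS.
Proof.
apply/andP; split; first by apply/subsetP=> a /chain_autP[].
apply/subsetP=> b Gb; have FbA := Aut_fusion_hom Gb; rewrite inE.
have FbV := Aut_fusion_hom (groupVr Gb).
apply/subsetP=> _ /imsetP[a /chain_autP[Fa Ta] ->]; apply/chain_autP.
split=> [|i x ltin Ax Tx].
  exact: (groupJ (Fa : a \in Aut_fusion_group fusF sAS) Gb).
have FaA := Aut_fusion_hom Fa.
have Ay := fusion_mem fusF FbV Ax.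
have Ty := strongly_closed_mem fusF (closedT _) FbV Ax Tx.
rewrite -[x](permKV b) permJ; set y := b^-1 x in Ay Ty *.
have Aay := fusion_mem fusF FaA Ay.
have Auy : y^-1 * a y \in A by rewrite groupM ?groupV.
rewrite -(mulKVg y (a y)) (fusionM fusF FbA) // mulKg.
exact: (strongly_closed_mem fusF (closedT i) FbA Auy (Ta i y ltin Ay Ty)).
Qed.


(* chain_aut A is a normal p-subgroup of Aut_F(A), so it lies in the Sylow
   subgroup Aut_S(A); it contains the conjugations by elements of N_P(A). *)
Lemma norm_sub_Nphi A a : fully_normalized S F A -> A \subset S ->
  a \in Aut_fusion F A -> 'N_P(A) \subset Nphi S A A a.
Proof.
move=> nA sAS Fa; have [sPS _] := closedP; apply/subsetP=> g /setIP[Pg Ng].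
have NSg : g \in 'N_S(A) by apply/setIP; split=> //; exact: (subsetP sPS).
have Wg : conj_aut A g \in Group (chain_aut_group_set sAS).
  apply/chain_autP; split=> [|i x _ Ax Tx]; first exact: (conj_Aut_fusion fusF sAS).
  rewrite norm_conj_autE //.
  by apply: (subsetP (cenT i)); rewrite mem_commg.
have Wga : conj_aut A g ^ a \in Group (chain_aut_group_set sAS).
  by rewrite memJ_norm // (subsetP (normal_norm (chain_aut_normal sAS))).
have [_ sylA] := saturated_sylow satF sAS nA.
have sylA' : p.-Sylow(Aut_fusion_group fusF sAS) (conj_aut A @* 'N_S(A)) by [].
have sWS := subset_trans
  (pcore_max (pgroup_chain_aut sAS) (chain_aut_normal sAS))
  (pcore_sub_Hall sylA').
have /morphimP[k Nk NSk Eak] := subsetP sWS _ Wga.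
rewrite inE NSg /=; apply/exists_inP; exists k => //.
apply/forall_inP=> x Ax; apply/eqP.
have Aax := fusion_mem fusF (Aut_fusion_hom Fa) Ax.
by rewrite -(norm_conj_autE Nk) // -Eak permJ norm_conj_autE.
Qed.

(** The image of g is generated by the images of P and A, which are P by strong closure and C by
    assumption. *)
Lemma extension_iso A C f g : fusion_iso F A C f -> F (P <*> A)%G S g ->
  {in A, g =1 f} -> fusion_iso F (P <*> A)%G (P <*> C)%G g.
Proof.
move=> iso_f Fg Eg; apply: (fusion_isoP fusF Fg).
have [mg _ _] := fusion_inj fusF Fg.
have sPA : P \subset P <*> A := joing_subl P A.
have sAA : A \subset P <*> A := joing_subr P A.
rewrite -[g @: _](morphimEdom [morphism of morphm mg]) /=.
rewrite morphimY // !morphimEsub //=.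
rewrite (strongly_closed_im fusF closedP Fg) //.
by rewrite (eq_in_imset Eg) (fusion_iso_im fusF iso_f).
Qed.

(** Normalizers grow in the p-group PA. If x * u normalizes A and is outside A, with x in A and u in
    P, then u is in 'N_P(A) but not in A. *)
Lemma proper_norm_join A : A \subset S -> ~~ (P \subset A) ->
  A \proper A <*> 'N_P(A).
Proof.
move=> sAS nPA; have [sPS _] := closedP.
rewrite properE joing_subl join_subG subxx /=.
have nilPA : nilpotent (P <*> A).
  by apply: (pgroup_nil (pgroupS _ (fusion_pgroup fusF))); rewrite join_subG sPS.
have ltA : A \proper P <*> A.
  by rewrite properE joing_subr join_subG subxx andbT.
have nPSA : A \subset 'N(P).
  by rewrite (subset_trans sAS) ?normal_norm // (strongly_closed_normal fusF).
have /properP[_ [y /setIP[]]] := nilpotent_proper_norm nilPA ltA.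
rewrite /= joingC (norm_joinEl nPSA) => /mulsgP[x u Ax Pu ->] Nxu nAxu.
apply: contra nAxu => /subsetP sNA; rewrite groupM // sNA // inE Pu /=.
by rewrite -(groupMl u (subsetP (normG A) x Ax)).
Qed.

Lemma extension_over A f : F A S f ->
  exists2 g, F (P <*> A)%G S g & {in A, g =1 f}.
Proof.
have [m leAm] := ubnP (#|S| - #|A|)%N.
elim: m A f leAm => // m IHm A f leAm Ff.
have [sPS _] := closedP; have sAS := fusion_dom fusF Ff.
have [sPA|nPA] := boolP (P \subset A).
  by exists f => //; have -> : (P <*> A)%G = A by apply/val_inj/joing_idPr.
(* Both the decrease of the measure and the growth of normalizers in S require A to be proper in
   S. *)
have ltAS : #|A| < #|S|.
  rewrite proper_card // properE sAS /=.
  by apply: contra nPA; apply: subset_trans.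
(* It suffices to extend to a subgroup larger than A. *)
have IH A1 A2 g h : #|A1| = #|A| -> A1 \proper A2 -> F A2 S g ->
    {in A1, g =1 h} -> exists2 e, F (P <*> A1)%G S e & {in A1, e =1 h}.
  move=> cA ltA Fg Eg; have sA := proper_sub ltA.
  have [|e Fe Ee] := IHm A2 g _ Fg.
    rewrite -ltnS; apply: leq_trans leAm; rewrite ltnS ltn_sub2l //.
    by rewrite -cA proper_card.
  exists e; first by apply: (fusion_sub fusF _ Fe); apply: genS; apply: setUS.
  by move=> x Ax; rewrite Ee ?Eg // (subsetP sA).
(* Since 'N_S(A1) is larger than A1, the extension from [extend_to_normalizer] feeds [IH]; the price
   is that h is replaced by another isomorphism psi onto C. *)
have ext_norm A1 C h : #|A1| = #|A| -> fusion_iso F A1 C h ->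
    fully_normalized S F C -> exists psi e, [/\ fusion_iso F A1 C psi,
      fusion_iso F (P <*> A1)%G (P <*> C)%G e & {in A1, e =1 psi}].
  move=> cA iso_h nC; have [Fh _] := iso_h; have sA1 := fusion_dom fusF Fh.
  have [psi [g [iso_psi Fg Eg]]] := extend_to_normalizer iso_h nC.
  have ltA1 : A1 \proper 'N_S(A1).
    apply: nilpotent_proper_norm (pgroup_nil (fusion_pgroup fusF)) _.
    by rewrite properEcard sA1 cA.
  have [e Fe Ee] := IH _ _ _ _ cA ltA1 Fg Eg.
  by exists psi, e; split=> //; apply: extension_iso Ee.
(* A and its image B under f are both sent to one fully normalized C, by psi and psi2 with
   extensions e1 and e2. This leaves the automorphism a of C that agrees with psi2 \o f \o
   psi^-1. *)
have [C [f0 [iso_f0 nC]]] := fully_normalized_conjugate fusF sAS.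
have [psi [e1 [iso_psi iso_e1 Ee1]]] := ext_norm A C f0 erefl iso_f0 nC.
have [B imf] := inj_hom_group (fusion_inj fusF Ff).
have iso_f := fusion_isoP fusF Ff imf.
have [_ injf _] := fusion_inj fusF Ff.
have cB : #|B| = #|A| by rewrite -imf card_in_imset.
have iso_sym A1 B1 h : fusion_iso F A1 B1 h -> exists2 k, fusion_iso F B1 A1 k &
    {in A1, cancel h k} /\ {in B1, cancel k h}.
  by case=> Fh [k Fk [hK kK]]; exists k => //; split=> //; exists h.
have [f' iso_f' _] := iso_sym _ _ _ iso_f.
have iso_BC := fusion_iso_comp fusF iso_f' iso_f0.
have [psi2 [e2 [iso_psi2 iso_e2 Ee2]]] := ext_norm B C _ cB iso_BC nC.
have [psi' iso_psi' [psiK psi'K]] := iso_sym _ _ _ iso_psi.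
have [e2' [Fe2' _] [e2K _]] := iso_sym _ _ _ iso_e2.
have [Fpsi _] := iso_psi.
have sCS := fusion_cod fusF Fpsi.
have iso_al := fusion_iso_comp fusF iso_psi' (fusion_iso_comp fusF iso_f iso_psi2).
have [a Fa Ea] := Aut_fusionP fusF iso_al.1.
have nPC : ~~ (P \subset C).
  apply: contra nPA => sPC; have [Fpsi' _] := iso_psi'.
  rewrite -(strongly_closed_im fusF closedP Fpsi' sPC) -(fusion_iso_im fusF iso_psi').
  exact: imsetS.
have iso_a : fusion_iso F C C a.
  apply: (fusion_isoP fusF (Aut_fusion_hom Fa)).
  by rewrite (eq_in_imset Ea) (fusion_iso_im fusF iso_al).
have [cC _] := saturated_sylow satF sCS nC.
have [g Fg Eg] := saturated_extension satF iso_a cC.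
(* C and 'N_P(C) both lie in N_a, so g restricts to this subgroup, which is larger than C because P
   is not contained in C. *)
have [] := IH C (C <*> 'N_P(C))%G g a.
- by rewrite -(fusion_iso_im fusF iso_f0) card_in_imset //;
    case: (fusion_inj fusF iso_f0.1).
- exact: proper_norm_join.
- apply: (fusion_sub fusF _ Fg); rewrite /= join_subG norm_sub_Nphi // andbT.
  exact: (sub_Nphi fusF iso_a).
- exact: Eg.
move=> e Fe Ee; have [FeC _] := extension_iso iso_a Fe Ee.
(* On A this is psi, then a, then the inverse of psi2, that is, f. *)
exists (e2' \o (e \o e1)).
  apply: (fusion_widen fusF _ (subxx S)
    (fusion_comp fusF (fusion_comp fusF iso_e1.1 FeC) Fe2')).
  by rewrite join_subG sPS -imf; case: (fusion_inj fusF Ff).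
move=> x Ax /=; have Cx := fusion_mem fusF Fpsi Ax.
have Bfx := fusion_mem fusF iso_f.1 Ax.
rewrite Ee1 // Ee // Ea //= psiK // -Ee2 // e2K //.
exact: (subsetP (joing_subr P B)).
Qed.

Lemma central_series_normal : normal_in_fusion S F P.
Proof.
split=> [|A B f Ff]; first exact: (strongly_closed_normal fusF closedP).
have sBS := fusion_cod fusF Ff; have [sPS _] := closedP.
have [g Fg Eg] := extension_over (fusion_widen fusF sBS (subxx S) Ff).
have [C imf] := inj_hom_group (fusion_inj fusF Ff).
have [Fg' _] := extension_iso (fusion_isoP fusF Ff imf) Fg Eg.
have sCB : C \subset B by rewrite -imf; case: (fusion_inj fusF Ff).
exists g; split=> //.
  apply: (fusion_widen fusF _ _ Fg'); last by rewrite join_subG sPS.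
  by apply: genS; apply: setUS.
exact: (strongly_closed_im fusF closedP Fg (joing_subl P A)).
Qed.

End CentralSeries.
End Saturated.

(** * The restriction of F to the subgroups of P, transported along j *)

Section Restriction.

Variables (p : nat) (gT sT : finGroupType) (P : {group gT}) (S : {group sT}).
Variables (j : {morphism P >-> sT}) (injj : 'injm j) (F : hom_system sT).
Hypothesis fusF : fusion_system p S F.
Hypothesis closedP : strongly_closed S F (j @* P)%G.

Local Notation E := (fusion_restr injj F).
Local Notation j' := (invm injj).
Implicit Types A B C : {group gT}.

Lemma fusion_restrP A B f : reflect
  [/\ A \subset P, B \subset P, f @: A \subset B
    & F (j @* A)%G (j @* B)%G (j \o f \o j')] (E A B f).
Proof. exact: and4P. Qed.

Lemma fusion_restrI A B f k : A \subset P -> B \subset P ->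
  {in A, forall x, f x \in B} -> F (j @* A)%G (j @* B)%G k ->
  {in A, forall x, k (j x) = j (f x)} -> E A B f.
Proof.
move=> sAP sBP fAB Fk Ek; apply/fusion_restrP; split=> //.
  by apply/subsetP=> _ /imsetP[x Ax ->]; apply: fAB.
apply: (fusion_ext fusF Fk) => _ /morphimP[x Px Ax ->] /=.
by rewrite Ek // invmE.
Qed.

Lemma fusion_restr_hom A B f : E A B f ->
  exists k, [/\ F (j @* A)%G (j @* B)%G k, {in A, forall x, k (j x) = j (f x)}
    & {in A, forall x, f x \in B}].
Proof.
case/fusion_restrP=> sAP sBP /subsetP sf Fk; exists (j \o f \o j'); split=> //.
  by move=> x Ax /=; rewrite invmE // (subsetP sAP).
by move=> x Ax; apply: sf; apply: imset_f.
Qed.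

Lemma fusion_restr_pull A B k : A \subset P -> B \subset P ->
  F (j @* A)%G (j @* B)%G k -> E A B (j' \o k \o j).
Proof.
move=> sAP sBP Fk.
have kB x : x \in A -> exists2 y, y \in B & k (j x) = j y.
  move=> Ax; have := fusion_mem fusF Fk (mem_morphim j (subsetP sAP x Ax) Ax).
  by case/morphimP=> y _ By ->; exists y.
apply: (fusion_restrI sAP sBP _ Fk) => x Ax /=; have [y By ->] := kB x Ax.
  by rewrite invmE // (subsetP sBP).
by rewrite invmE // (subsetP sBP).
Qed.

Lemma fusion_restr_fusion : fusion_system p P E.
Proof.
have sPS : j @* P \subset S := closedP.1.
have pP : p.-group P.
  by rewrite -(injm_pgroup injj) ?(pgroupS sPS) ?(fusion_pgroup fusF).
split=> //.
- by move=> A B f /and4P[].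
- move=> A B f EAB; have [sAP sBP sfB _] := fusion_restrP _ _ _ EAB.
  have [k [Fk Ek fB]] := fusion_restr_hom EAB.
  have [_ injk _] := fusion_inj fusF Fk.
  have Pm x : x \in A -> x \in P := subsetP sAP x.
  have Pf x : x \in A -> f x \in P by move=> Ax; apply: (subsetP sBP); apply: fB.
  split=> //.
    apply/morphicP=> x y Ax Ay; apply: (injmP injj); rewrite ?groupM ?Pf ?groupM //.
    rewrite morphM ?Pf // -!Ek ?groupM // morphM ?Pm //.
    by rewrite (fusionM fusF Fk) ?mem_morphim ?Pm.
  move=> x y Ax Ay Efxy; apply: (injmP injj); rewrite ?Pm //.
  by apply: injk; rewrite ?mem_morphim ?Pm // !Ek // Efxy.
- move=> A B f g EAB Eg; have [sAP sBP _ _] := fusion_restrP _ _ _ EAB.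
  have [k [Fk Ek fB]] := fusion_restr_hom EAB.
  by apply: (fusion_restrI sAP sBP _ Fk) => x Ax; rewrite -Eg ?Ek ?fB.
- move=> A B s sAP sBP Ps sAB.
  have Pm x : x \in A -> x \in P := subsetP sAP x.
  apply: (fusion_restrI (k := conjg^~ (j s)) sAP sBP) => [x Ax||x Ax].
  + by apply: (subsetP sAB); rewrite memJ_conjg.
  + apply: (fusion_conj fusF); rewrite ?(subset_trans _ sPS) ?morphimS //.
      by rewrite (subsetP sPS) ?mem_morphim.
    by rewrite -morphimJ // morphimS.
  by rewrite morphJ ?(Pm x).
- move=> A B C f g EAB EBC; have [sAP sBP _ _] := fusion_restrP _ _ _ EAB.
  have [_ sCP _ _] := fusion_restrP _ _ _ EBC.
  have [k [Fk Ek fB]] := fusion_restr_hom EAB.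
  have [l [Fl El gC]] := fusion_restr_hom EBC.
  apply: (fusion_restrI sAP sCP _ (fusion_comp fusF Fk Fl)) => x Ax /=.
    by rewrite gC ?fB.
  by rewrite Ek // El ?fB.
move=> A B f EAB; have [sAP sBP _ _] := fusion_restrP _ _ _ EAB.
have [k [Fk Ek fB]] := fusion_restr_hom EAB.
have [D sDB [FD [l Fl [kK lK]]]] := fusion_factor fusF Fk.
(* For the factorization axiom: the image D in S lies in j @* B, so by injectivity its preimage C
   lies in B, and j maps C onto D. *)
pose C := (j @*^-1 D)%G.
have sDP : D \subset j @* P by apply: subset_trans sDB _; apply: morphimS.
have jC : (j @* C)%G = D by apply: val_inj; rewrite /= morphpreK.
have sCB : C \subset B.
  apply/subsetP=> x Cx; have /setIP[Px] := Cx; rewrite inE => Djx.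
  have /morphimP[y Py By Exy] := subsetP sDB _ Djx.
  by rewrite (injmP injj _ _ Px Py Exy).
have sCP := subset_trans sCB sBP.
rewrite -jC in FD Fl lK.
have fC x : x \in A -> f x \in C.
  move=> Ax; have Pfx := subsetP sBP _ (fB x Ax).
  rewrite inE Pfx inE -Ek // -jC.
  exact: (fusion_mem fusF FD (mem_morphim j (subsetP sAP x Ax) Ax)).
exists C => //; split; first exact: fusion_restrI FD Ek.
exists (j' \o l \o j); first exact: fusion_restr_pull.
split=> [x Ax|x Cx] /=.
  by rewrite -Ek // kK ?mem_morphim ?(subsetP sAP) // invmE ?(subsetP sAP).
have Px := subsetP sCP x Cx; have jCx := mem_morphim j Px Cx.
have /morphimP[y Py Ay Ely] := fusion_mem fusF Fl jCx.
rewrite Ely invmE //; apply: (injmP injj) => //.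
  by rewrite (subsetP sCP) ?fC.
by rewrite -Ek // -Ely lK.
Qed.

(** For A inside P the join P <*> A is P, so the extension given by F is defined on exactly j @* P
    and pulls back to an automorphism of P. *)
Lemma fusion_restr_normal : normal_in_fusion S F (j @* P)%G ->
  normal_in_fusion P E P.
Proof.
case=> _ norF; split=> // A B f EAB.
have [sAP sBP _ _] := fusion_restrP _ _ _ EAB.
have [k [Fk Ek fB]] := fusion_restr_hom EAB.
have [l [Fl El _]] := norF _ _ _ Fk.
have idP (Q : {group gT}) : Q \subset P -> (P <*> Q)%G = P.
  by move=> sQP; apply/val_inj/joing_idPl.
have idjP (Q : {group gT}) : Q \subset P -> (j @* P <*> j @* Q)%G = (j @* P)%G.
  by move=> sQP; apply/val_inj/joing_idPl/morphimS.
have FP : F (j @* P)%G (j @* P)%G l by move: Fl; rewrite !idjP.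
have EP := fusion_restr_pull (subxx P) (subxx P) FP.
exists (j' \o l \o j); split; first by rewrite !idP.
  move=> x Ax /=; have Px := subsetP sAP x Ax.
  by rewrite El ?mem_morphim // Ek // invmE // (subsetP sBP) ?fB.
have [_ inj_l sub_l] := fusion_inj fusion_restr_fusion EP.
by apply/eqP; rewrite eqEcard sub_l card_in_imset /=.
Qed.

(** Strong closure of j @* P puts the values of f on <[j x]> inside j @* P, so f pulls back to a
    morphism of E. Its extension to P is an automorphism of P, which preserves K. *)
Lemma char_strongly_closed (K : {group gT}) : normal_in_fusion P E P ->
  K \char P -> strongly_closed S F (j @* K)%G.
Proof.
case=> _ norE charK; have sKP := char_sub charK.
have [sPS _] := closedP.
split=> [|y f]; first by apply: subset_trans sPS; apply: morphimS.
case/morphimP=> x Px Kx -> Ff.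
have sxP : <[x]> \subset P by rewrite cycle_subG.
have jx : (j @* <[x]>)%G = <[j x]>%G by apply: val_inj; rewrite /= morphim_cycle.
have Ff' : F <[j x]>%G (j @* P)%G f.
  apply: (fusion_corestrict fusF Ff) sPS.
  apply/subsetP=> _ /imsetP[z jz ->].
  apply: (strongly_closed_mem fusF closedP Ff jz).
  by apply: subsetP jz; rewrite cycle_subG mem_morphim.
rewrite -jx in Ff'.
have [g [Eg Egx imgP]] := norE _ _ _ (fusion_restr_pull sxP (subxx P) Ff').
have idP (Q : {group gT}) : Q \subset P -> (P <*> Q)%G = P.
  by move=> sQP; apply/val_inj/joing_idPl.
rewrite !idP // in Eg.
have [mg injg _] := fusion_inj fusion_restr_fusion Eg.
have /charP[_ /(_ (morphm_morphism mg))] := charK.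
rewrite !morphimEsub //= imgP => imgK.
have Kgx : g x \in K by rewrite -(imgK _ erefl) ?imset_f //; apply/injmP.
have := fusion_mem fusF Ff' (mem_morphim j Px (cycle_id x)).
rewrite Egx ?cycle_id //= in Kgx.
by case/morphimP=> z Pz _ Ez; rewrite Ez invmE // in Kgx *; rewrite mem_morphim.
Qed.

End Restriction.

(** * Equivalence of the two notions of resistance *)

Theorem corollary3p25 (p : nat) (gT : finGroupType) (P : {group gT})
    (hp : prime p) (hP : pgroup p P) :
  strongly_resistant p P <-> resistant_semisaturated p P.
Proof.
split=> [resP E [_ [sT [S [j [injj [F [satF cloP eqE]]]]]]]
        |resP sT S j F injj satF cloP].
  have fusF := saturated_fusion satF.
  have [nP norE] := fusion_restr_normal injj fusF cloP (resP _ _ _ _ injj satF cloP).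
  (* E equals the restriction only pointwise, so normality is carried over one morphism at a
     time. *)
  split=> // A B f; rewrite eqE => /norE[g [Eg Efg gP]].
  by exists g; split; rewrite // eqE.
have fusF := saturated_fusion satF.
have norE : normal_in_fusion P (fusion_restr injj F) P.
  apply: resP; split; first exact: (fusion_restr_fusion injj fusF cloP).
  by exists sT, S, j, injj, F.
have [sPS _] := cloP; pose c := nil_class P.
have nilP := pgroup_nil hP.
have clP : 'Z_c(P) = P by exact: (ucn_nil_classP c nilP (leqnn c)).
(* The upper central series reaches P at its class c, and every later term is S; hence the length
   c.+1. *)
pose T i := if i <= c then (j @* 'Z_i(P))%G else S.
apply: (central_series_normal satF (n := c.+1) (T := T)) => //.
- move=> i; rewrite /T; case: ifP => _.
    exact: (char_strongly_closed fusF cloP norE (ucn_char i P)).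
  by split=> // x f Sx Ff; apply: (fusion_mem fusF Ff); apply: cycle_id.
- by apply: val_inj; rewrite /T /= ucn0 morphim1.
- by rewrite /T ltnn.
(* Below c this is centrality of the series, beyond c both terms are S, and at i = c it says that S
   normalizes j @* P. *)
move=> i; rewrite /T; case: ltngtP => [ltic|ltci|eqic].
- by rewrite /= -morphimR ?ucn_sub // morphimS // ucn_comm.
- by rewrite commg_subl (subset_trans sPS) ?normG.
rewrite /= eqic clP commg_subr.
exact: normal_norm (strongly_closed_normal fusF cloP).
Qed.
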